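(* Let $t\in\mathbb{R}$. For every $h\in\mathbb{H}_t$, the operator $M_h$ is normal in $\mathcal{M}_t$, i.e. $M_h^{*}M_h=M_hM_h^{*}$.
   Context: For $t\in\mathbb{R}$, the $t$-scaled hypercomplex ring $\mathbb{H}_t$ is the set $\mathbb{C}^2$ with the usual vector addition and the multiplication $(a_1,b_1)\cdot_t(a_2,b_2)=(a_1a_2+t\,b_1\overline{b_2},\;a_1b_2+b_1\overline{a_2})$, regarded also as a vector space over $\mathbb{R}$; $(a,b)^{\dagger}=(\overline{a},-b)$. For $\eta\in\mathbb{H}_t$, $M_\eta:\mathbb{H}_t\to\mathbb{H}_t$ is the $\mathbb{R}$-linear multiplication operator $M_\eta(h)=\eta\cdot_t h$. The hypercomplex algebra over $\mathbb{R}$ is $\mathcal{M}_t=\{M_\eta:\eta\in\mathbb{H}_t\}$, with operator addition and composition and with adjoint $M_\eta^{*}=M_{\eta^{\dagger}}$. *)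

(* Defs.v *)
From HB Require Import structures.
From mathcomp Require Import all_boot all_order all_algebra all_field.
From mathcomp Require Import reals complex ring.

Set Implicit Arguments.
Unset Strict Implicit.
Unset Printing Implicit Defensive.

Import Order.TTheory GRing.Theory Num.Theory.

Local Open Scope ring_scope.

(* The parameter t is kept in the type, so that it determines the product:
   a term of type [hypercomplex t] is just a pair of complex numbers. *)
Definition hypercomplex (R : realType) (t : R) : Type := (R[i] * R[i])%type.

HB.instance Definition _ (R : realType) (t : R) :=
  GRing.Zmodule.copy (hypercomplex t) (R[i] * R[i])%type.

Section HypercomplexRing.
Variables (R : realType) (t : R).
Local Notation H := (hypercomplex t).
Implicit Types (k : R) (x y z : H).

Definition hmul x y : H :=
  (x.1 * y.1 + t%:C%C * x.2 * y.2^*, x.1 * y.2 + x.2 * y.1^*).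

Definition hone : H := (1, 0).

Definition hscale k x : H := (k%:C%C * x.1, k%:C%C * x.2).

Definition hdag x : H := (x.1^*, - x.2).

Fact conj_real k : (k%:C%C)^* = k%:C%C.
Proof. exact: conjc_real. Qed.

Fact hmulA : associative hmul.
Proof.
move=> [a1 b1] [a2 b2] [a3 b3]; rewrite /hmul /=.
by congr (_, _); rewrite !(rmorphD, rmorphM) /= ?conjCK ?conj_real; ring.
Qed.

Fact hmul1x : left_id hone hmul.
Proof. by case=> a b; rewrite /hmul /=; congr (_, _); ring. Qed.

Fact hmulx1 : right_id hone hmul.
Proof.
by case=> a b; rewrite /hmul /= !(rmorph0, rmorph1); congr (_, _); ring.
Qed.

Fact hmulDl : left_distributive hmul +%R.
Proof.
by case=> a1 b1 [a2 b2] [a3 b3]; congr (_, _); rewrite /=; ring.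
Qed.

Fact hmulDr : right_distributive hmul +%R.
Proof.
by case=> a1 b1 [a2 b2] [a3 b3]; congr (_, _); rewrite /= ?rmorphD; ring.
Qed.

Fact hone_neq0 : hone != 0.
Proof. by apply/eqP => -[/eqP]; rewrite oner_eq0. Qed.

HB.instance Definition _ := GRing.Zmodule_isNzRing.Build H
  hmulA hmul1x hmulx1 hmulDl hmulDr hone_neq0.

Fact hscaleA k l x : hscale k (hscale l x) = hscale (k * l) x.
Proof. by rewrite /hscale /= rmorphM !mulrA. Qed.

Fact hscale1 : left_id 1 hscale.
Proof. by case=> a b; rewrite /hscale rmorph1 !mul1r. Qed.

Fact hscaleDr : right_distributive hscale +%R.
Proof. by move=> k [a b] [c d]; congr (_, _); rewrite /= mulrDr. Qed.

Fact hscaleDl x : {morph hscale^~ x : k l / k + l}.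
Proof. by move=> k l; rewrite /hscale rmorphD /= !mulrDl. Qed.

HB.instance Definition _ := GRing.Zmodule_isLmodule.Build R H
  hscaleA hscale1 hscaleDr hscaleDl.

Fact hscaleAl k x y : k *: (x * y) = k *: x * y.
Proof. by congr (_, _); rewrite /=; ring. Qed.

HB.instance Definition _ := GRing.Lmodule_isLalgebra.Build R H hscaleAl.

Fact hscaleAr k x y : k *: (x * y) = x * (k *: y).
Proof.
by congr (_, _); rewrite /= ?rmorphM /= ?conj_real; ring.
Qed.

HB.instance Definition _ := GRing.Lalgebra_isAlgebra.Build R H hscaleAr.

Definition hcoord x : 'rV[R]_4 :=
  \row_i [:: complex.Re x.1; complex.Im x.1; complex.Re x.2; complex.Im x.2]`_i.

Fact hcoord_vect_axiom : Vector.axiom 4 H.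
Proof.
exists hcoord.
  move=> k [[a b] [c d]] [[a' b'] [c' d']]; apply/rowP => i; rewrite !mxE /=.
  by case: i => -[|[|[|[|]]]] //= _; ring.
exists (fun u : 'rV[R]_4 => ((u 0 (inord 0) +i* u 0 (inord 1))%C,
                             (u 0 (inord 2) +i* u 0 (inord 3))%C)).
  by case=> [[a b] [c d]]; rewrite !mxE !inordK.
move=> u; apply/rowP => i; rewrite mxE /=.
by case: i => -[|[|[|[|]]]] //= lt_i4; congr (u 0 _);
   apply: val_inj; rewrite /= inordK.
Qed.

HB.instance Definition _ := Lmodule_hasFinDim.Build R H hcoord_vect_axiom.

Definition mulop (eta : H) : 'End(H) := linfun (eta \*o @idfun H).

Lemma mulopE eta x : mulop eta x = eta * x.
Proof. by rewrite lfunE. Qed.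

Fact mulop_is_linear : linear mulop.
Proof.
move=> k x y; apply/lfunP => z.
by rewrite add_lfunE scale_lfunE !mulopE mulrDl scalerAl.
Qed.

HB.instance Definition _ := GRing.isLinear.Build R H 'End(H) *:%R
  mulop mulop_is_linear.

Lemma mulop_inj : injective mulop.
Proof. by move=> x y /lfunP/(_ 1); rewrite !mulopE !mulr1. Qed.

Lemma mulopM x y : mulop (x * y) = (mulop x \o mulop y)%VF.
Proof. by apply/lfunP => z; rewrite comp_lfunE !mulopE mulrA. Qed.

(* The set of all operators [mulop eta], see [hyperalgP]; addition is that of
   'End(H) and the product is the composition \o. *)
Definition hyperalg : {vspace 'End(H)} := limg (linfun mulop).

Lemma hyperalgP (f : 'End(H)) :
  reflect (exists eta, f = mulop eta) (f \in hyperalg).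
Proof.
apply: (iffP memv_imgP) => [[eta _ ->]|[eta ->]]; exists eta => //.
- by rewrite lfunE.
- exact: memvf.
- by rewrite lfunE.
Qed.

Lemma hyperalg_comp (f g : 'End(H)) :
  f \in hyperalg -> g \in hyperalg -> (f \o g)%VF \in hyperalg.
Proof.
move=> /hyperalgP[x ->] /hyperalgP[y ->]; rewrite -mulopM.
by apply/hyperalgP; exists (x * y).
Qed.

(* As (mulop eta) 1 = eta, this is the map mulop eta |-> mulop (hdag eta) on
   hyperalg, see [hadj_mulop]; its values outside hyperalg are irrelevant. *)
Definition hadj (f : 'End(H)) : 'End(H) := mulop (hdag (f 1)).

Lemma hadj_mulop eta : hadj (mulop eta) = mulop (hdag eta).
Proof. by rewrite /hadj mulopE mulr1. Qed.

Definition normal_in_hyperalg (f : 'End(H)) : Prop :=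
  f \in hyperalg /\ (hadj f \o f)%VF = (f \o hadj f)%VF.

End HypercomplexRing.

(* Main.v *)
Require Import Defs.
From mathcomp Require Import all_boot all_order all_algebra all_field.
From mathcomp Require Import reals complex.
From mathcomp Require Import ring.

(** Since eta |-> mulop eta turns products into compositions and the adjoint
    into the operator of the dagger, normality of mulop h amounts to h commuting
    with its dagger. Writing h = (a, b), both products are the quaternion-like
    norm (|a|^2 - t |b|^2, 0): the cross terms in the second component cancel,
    whichever of the two factors comes first. *)

Import GRing.Theory Num.Theory.
Local Open Scope ring_scope.

Lemma hdag_mul_comm (R : realType) (t : R) (h : hypercomplex t) :
  hdag h * h = h * hdag h.
Proof.
case: h => a b.
congr (_, _); rewrite /= ?rmorphN /= ?conjCK; ring.
Qed.

Theorem theorem5p7 (R : realType) (t : R) (h : hypercomplex t) :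
  normal_in_hyperalg (mulop h).
Proof.
split; first by apply/hyperalgP; exists h.
by rewrite hadj_mulop -!mulopM hdag_mul_comm.
Qed.
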